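(* Let $\Omega=(0,1)$ and $T>0$, and let $B_{\mathrm{ext}}=\partial_x\psi_{\mathrm{ext}}$, where $\psi_{\mathrm{ext}}\in C^2(\Omega)$ satisfies $|\psi_{\mathrm{ext}}(x)|\ge \frac{c_0}{\mathrm{dist}(x,\partial\Omega)^{\gamma}}-\frac1{c_0}$ for all $x\in\Omega$, with constants $\gamma>0$, $c_0>0$. Assume that $E=(E_1,E_2)$ and $B$ belong to $C^1([0,T]\times\Omega)$ and satisfy $\partial_tB=-\partial_xE_2$, and that there exist constants $C_0,C_0'>0$ such that $$|E(s,y)|\le C_0\quad\text{and}\quad|B(s,y)|\le C_0'\qquad\text{for all }(s,y)\in[0,T]\times\Omega .$$ Let $(t,x,v)\in(0,T]\times\Omega\times\mathbb{R}^2$ and let $(X(s),V(s))$ be a $C^1$ solution of the characteristic system $$\frac{dX}{ds}=\hat V_1(s),\quad\frac{dV_1}{ds}=E_1(s,X)+\hat V_2(s)\,\check B(s,X),\quad\frac{dV_2}{ds}=E_2(s,X)-\hat V_1(s)\,\check B(s,X),\quad X(t)=x,\ V(t)=v,$$ in the time interval $[t-\alpha,t+\alpha]\subset[0,T]$ for some $\alpha>0$. Then $$\mathrm{dist}(X(s),\partial\Omega)^\gamma\ \ge\ \frac{c_0}{c_0^{-1}+2|v|+C_0'+3C_0\alpha+|\psi_{\mathrm{ext}}(x)|}\qquad\text{for all }s\in[t-\alpha,t+\alpha].$$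
   Context: Notation: $\check B(s,y)=B(s,y)+B_{\mathrm{ext}}(y)$; for $w\in\mathbb{R}^2$, $\hat w=w/\sqrt{1+|w|^2}$, so $\hat V=(\hat V_1,\hat V_2)=V/\sqrt{1+|V|^2}$. A solution of the characteristic system on an interval is understood to satisfy $X(s)\in\Omega$ there (the fields are defined only for $x\in\Omega$). *)

(* Defs.v *)
From Stdlib Require Import Reals.
From Coquelicot Require Import Coquelicot.
Open Scope R_scope.

Definition Omega (x : R) : Prop := 0 < x < 1.

(* The boundary of Omega is the two-point set {0, 1}. *)
Definition dist_bdry (x : R) : R := Rmin (Rabs (x - 0)) (Rabs (x - 1)).

Definition Icc (a b s : R) : Prop := a <= s <= b.

(* Derivative relative to D: two-sided at interior points of D, one-sided at
   the endpoints when D is a closed interval.  Values of f off D are irrelevant. *)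
Definition is_derive_within (D : R -> Prop) (f : R -> R) (x l : R) : Prop :=
  filterdiff f (within D (locally x)) (fun h => scal h l).

Definition C1_on (D : R -> Prop) (f : R -> R) : Prop :=
  exists f' : R -> R,
    (forall s, D s -> is_derive_within D f s (f' s)) /\ continuous_on D f'.

Definition C2_Omega (psi : R -> R) : Prop :=
  forall k : nat, (k <= 2)%nat -> forall x, Omega x ->
    ex_derive_n psi k x /\ continuous (Derive_n psi k) x.

(* Joint continuity, relative to [0,T] x Omega. *)
Definition C0_cyl (T : R) (f : R -> R -> R) : Prop :=
  continuous_on (fun p : R * R => Icc 0 T (fst p) /\ Omega (snd p))
                (fun p : R * R => f (fst p) (snd p)).

(* C^1([0,T] x Omega); the time derivative is one-sided at s = 0 and s = T. *)
Definition C1_cyl (T : R) (f : R -> R -> R) : Prop :=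
  C0_cyl T f /\
  exists ft fx : R -> R -> R,
    (forall s y, Icc 0 T s -> Omega y ->
       is_derive_within (Icc 0 T) (fun r => f r y) s (ft s y) /\
       is_derive (fun z => f s z) y (fx s y)) /\
    C0_cyl T ft /\ C0_cyl T fx.

(* Coquelicot's norm on R * R is the Euclidean one, sqrt (a^2 + b^2). *)
Definition enorm (w : R * R) : R := norm w.

Definition hat (w : R * R) : R * R :=
  (fst w / sqrt (1 + enorm w ^ 2), snd w / sqrt (1 + enorm w ^ 2)).

Definition char_solution (E : R -> R -> R * R) (B : R -> R -> R) (Bext : R -> R)
    (a b : R) (X : R -> R) (V : R -> R * R) : Prop :=
  let Bcheck s y := B s y + Bext y in
  C1_on (Icc a b) X /\
  C1_on (Icc a b) (fun s => fst (V s)) /\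
  C1_on (Icc a b) (fun s => snd (V s)) /\
  forall s, Icc a b s ->
    Omega (X s) /\
    is_derive_within (Icc a b) X s (fst (hat (V s))) /\
    is_derive_within (Icc a b) (fun r => fst (V r)) s
      (fst (E s (X s)) + snd (hat (V s)) * Bcheck s (X s)) /\
    is_derive_within (Icc a b) (fun r => snd (V r)) s
      (snd (E s (X s)) - fst (hat (V s)) * Bcheck s (X s)).

(* Main.v *)
Require Import Defs.
From Stdlib Require Import Reals Lra.
From Coquelicot Require Import Coquelicot.
Open Scope R_scope.

(** The magnetic force is perpendicular to the velocity, so only [E] changes
    the speed, at rate at most [C0]: [|V s| <= |v| + C0 |s - t|]
    ([speed_growth]).

    The singular external field is controlled through a canonical momentum.
    Let [Psi(s, y)] be the primitive of [B(s, .)] vanishing at [x].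
    Faraday's law [dB/ds = - dE2/dy] gives
    [dPsi/ds(s, y) = E2(s, x) - E2(s, y)].  Hence along the trajectory
    [[
      P(s) = V2(s) + Psi(s, X s) + psi_ext (X s)
    ]]
    the magnetic terms of [dV2/ds] cancel against the transport terms of [Psi]
    and [psi_ext], and [E2] at the moving point cancels as well, which leaves
    [P'(s) = E2(s, x)], of size at most [C0]
    ([is_derive_RInt_of_conservation_law]).  Since [Omega] has length one,
    [|Psi| <= C0'].  Solving for [psi_ext (X s)],
    [[
      |psi_ext (X s)| <= |psi_ext x| + |v2| + |V2 s| + C0' + C0 alpha
                      <= |psi_ext x| + 2 |v| + C0' + 2 C0 alpha,
    ]]
    and the blow-up of [psi_ext] at the boundary turns an upper bound on
    [|psi_ext (X s)|] into a lower bound on the distance.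

    The hypotheses give one-sided derivatives at the ends of the time
    intervals.  The differential argument is therefore carried out at times
    strictly inside [(t - alpha, t + alpha)], where all derivatives are
    two-sided, and the bound on [psi_ext (X s)] passes to the two end times by
    continuity ([Rabs_bound_extends_to_endpoints]). *)

(** * The Euclidean norm of the plane *)


Lemma enormE (w : R * R) : enorm w = sqrt (fst w ^ 2 + snd w ^ 2).
Proof.
  unfold enorm, norm; simpl; unfold prod_norm, norm; simpl; unfold abs; simpl.
  f_equal.
  rewrite !Rmult_1_r, <- !Rabs_mult, !Rabs_pos_eq; nra.
Qed.

Lemma enorm_ge0 (w : R * R) : 0 <= enorm w.
Proof. rewrite enormE; apply sqrt_pos. Qed.

Lemma enorm_sqr (w : R * R) : enorm w ^ 2 = fst w ^ 2 + snd w ^ 2.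
Proof. rewrite enormE, pow2_sqrt; nra. Qed.

Lemma Rabs_le_of_sqr_le (a b : R) : 0 <= b -> a ^ 2 <= b ^ 2 -> Rabs a <= b.
Proof. intros Hb H; apply Rabs_le; split; nra. Qed.

Lemma Rabs_snd_le_enorm (w : R * R) : Rabs (snd w) <= enorm w.
Proof.
  apply Rabs_le_of_sqr_le; [apply enorm_ge0 | rewrite enorm_sqr; nra].
Qed.

Lemma Cauchy_Schwarz_enorm (u w : R * R) :
  Rabs (fst u * fst w + snd u * snd w) <= enorm u * enorm w.
Proof.
  apply Rabs_le_of_sqr_le.
  - apply Rmult_le_pos; apply enorm_ge0.
  - rewrite Rpow_mult_distr, !enorm_sqr.
    pose proof (pow2_ge_0 (fst u * snd w - snd u * fst w)); nra.
Qed.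

(** * Interior points: from relative to two-sided regularity *)

Lemma locally_Ioo (a b s : R) : a < s < b -> locally s (fun r => a < r < b).
Proof. intros [Ha Hb]; apply filter_and; [apply (open_gt a) | apply (open_lt b)]; auto. Qed.

Lemma is_derive_within_interior (D : R -> Prop) (f : R -> R) (x l : R) :
  locally x D -> is_derive_within D f x l -> is_derive f x l.
Proof.
  intros HD [Hlin Hdom]; split; [exact Hlin |].
  intros y Hy eps.
  assert (Hw : is_filter_lim (within D (locally x)) y).
  { intros P HP; apply filter_le_within; exact (Hy P HP). }
  generalize (filter_and _ _ HD (Hdom y Hw eps)); apply filter_imp.
  intros z [H1 H2]; exact (H2 H1).
Qed.

Lemma locally_cylinder (T s y : R) :
  0 < s < T -> Omega y ->
  locally (s, y) (fun p : R * R => 0 < fst p < T /\ Omega (snd p)).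
Proof.
  intros Hs Hy.
  destruct (locally_Ioo _ _ _ Hs) as [d1 H1].
  destruct (locally_Ioo _ _ _ Hy) as [d2 H2].
  exists (mkposreal _ (Rmin_stable_in_posreal d1 d2)).
  intros p [Hp1 Hp2]; split; [apply H1 | apply H2];
    (eapply ball_le; [| eassumption]); simpl; [apply Rmin_l | apply Rmin_r].
Qed.

Lemma C0_cyl_interior (T : R) (f : R -> R -> R) (s y : R) :
  C0_cyl T f -> 0 < s < T -> Omega y -> continuity_2d_pt f s y.
Proof.
  intros Hf Hs Hy; apply continuity_2d_pt_filterlim.
  refine (continuous_continuous_on _ _ (s, y) _ Hf).
  generalize (locally_cylinder T s y Hs Hy); apply filter_imp.
  unfold Icc; intuition lra.
Qed.

Lemma continuous_of_continuity_2d (f : R -> R -> R) (s y : R) :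
  continuity_2d_pt f s y -> continuous (f s) y.
Proof.
  intros Hf; apply filterlim_locally; intros eps.
  exact (locally_2d_1d_const_x _ _ _ (Hf eps)).
Qed.

(** * The primitive of a density obeying a conservation law *)

Lemma Omega_between (a b z : R) :
  Omega a -> Omega b -> Rmin a b <= z <= Rmax a b -> Omega z.
Proof. unfold Omega, Rmin, Rmax; destruct (Rle_dec a b); lra. Qed.

Lemma ex_RInt_Omega (g : R -> R) (a b : R) :
  (forall z, Omega z -> continuous g z) -> Omega a -> Omega b -> ex_RInt g a b.
Proof.
  intros Hg Ha Hb; apply (ex_RInt_continuous (V := R_CompleteNormedModule)).
  intros z Hz; exact (Hg z (Omega_between a b z Ha Hb Hz)).
Qed.

Lemma Rabs_RInt_Omega_le (g : R -> R) (K a b : R) :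
  (forall z, Omega z -> continuous g z) ->
  (forall z, Omega z -> Rabs (g z) <= K) ->
  Omega a -> Omega b -> Rabs (RInt g a b) <= K.
Proof.
  intros Hc HK.
  assert (Hle : forall p q, p <= q -> Omega p -> Omega q ->
            Rabs (RInt g p q) <= K).
  { intros p q Hpq Hp Hq; apply Rle_trans with ((q - p) * K).
    - apply abs_RInt_le_const; [exact Hpq | apply ex_RInt_Omega; auto |].
      intros z Hz; apply HK; unfold Omega in *; lra.
    - pose proof (HK p Hp); pose proof (Rabs_pos (g p)).
      unfold Omega in Hp, Hq; nra. }
  intros Ha Hb; destruct (Rle_dec a b); [apply Hle; auto |].
  rewrite <- opp_RInt_swap by (apply ex_RInt_Omega; auto).
  unfold opp; simpl; rewrite Rabs_Ropp; apply Hle; auto; lra.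
Qed.

(** For a density [B] with flux [F] the mass between the fixed point [x] and
    the moving point [X r] changes by the flux difference plus the transport
    term at the moving end: differentiating under the integral replaces the
    time derivative of [B] by minus the space derivative of [F], which
    integrates exactly. *)
Lemma is_derive_RInt_of_conservation_law (T : R) (B F Fx : R -> R -> R)
    (X : R -> R) (x s l : R) :
  (forall r y, 0 < r < T -> Omega y -> continuity_2d_pt B r y) ->
  (forall r y, 0 < r < T -> Omega y -> continuity_2d_pt Fx r y) ->
  (forall r y, 0 < r < T -> Omega y -> is_derive (F r) y (Fx r y)) ->
  (forall r y, 0 < r < T -> Omega y -> is_derive (fun q => B q y) r (- Fx r y)) ->
  0 < s < T -> Omega x -> Omega (X s) -> is_derive X s l ->
  is_derive (fun r => RInt (B r) x (X r)) s
    (F s x - F s (X s) + B s (X s) * l).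
Proof.
  intros HB HFx HF HBt Hs Hx HXs HX.
  assert (HBint : forall a b, Omega a -> Omega b ->
            locally s (fun r => ex_RInt (B r) a b)).
  { intros a b Ha Hb; generalize (locally_Ioo _ _ _ Hs); apply filter_imp.
    intros r Hr; apply ex_RInt_Omega; auto.
    intros z Hz; apply continuous_of_continuity_2d, HB; auto. }
  assert (HDB : forall r y, 0 < r < T -> Omega y ->
            Derive (fun q => B q y) r = - Fx r y).
  { intros r y Hr Hy; apply is_derive_unique, HBt; auto. }
  assert (HDBc : forall r y, 0 < r < T -> Omega y ->
            continuity_2d_pt (fun u v => Derive (fun q => B q v) u) r y).
  { intros r y Hr Hy.
    apply continuity_2d_pt_ext_loc with (f := fun u v => - Fx u v).
    - apply locally_2d_locally.
      generalize (locally_cylinder T r y Hr Hy); apply filter_imp.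
      intros p [Hp1 Hp2]; symmetry; apply HDB; auto.
    - apply continuity_2d_pt_opp, HFx; auto. }
  (* The differentiation theorem needs its hypotheses on a whole neighbourhood
     of the moving end point, which therefore has to stay inside Omega. *)
  assert (Heps : exists eps : posreal, Omega (X s - eps) /\ Omega (X s + eps)).
  { assert (He : 0 < Rmin (X s) (1 - X s) / 2).
    { unfold Omega in HXs; apply Rmin_case; lra. }
    exists (mkposreal _ He); simpl; revert He.
    unfold Omega in *; unfold Rmin; destruct (Rle_dec (X s) (1 - X s)); lra. }
  destruct Heps as [eps [Hl Hr]].
  replace (F s x - F s (X s)) with
    (RInt (fun y => Derive (fun q => B q y) s) x (X s)).
  - apply is_derive_RInt_param_bound_comp_aux3; auto.
    + exists eps; apply HBint; auto.
    + exists eps; generalize (locally_Ioo _ _ _ Hs); apply filter_imp.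
      intros r Hr' y Hy; exists (- Fx r y); apply HBt; auto.
      revert Hl Hr Hx Hy; unfold Omega, Rmin, Rmax.
      destruct (Rle_dec x (X s - eps)), (Rle_dec x (X s + eps)); lra.
    + intros y Hy; apply HDBc; auto; exact (Omega_between _ _ _ Hx HXs Hy).
    + apply locally_2d_locally.
      generalize (locally_cylinder T s (X s) Hs HXs); apply filter_imp.
      intros p [Hp1 Hp2]; apply HDBc; auto.
    + apply continuity_pt_filterlim, continuous_of_continuity_2d, HB; auto.
  - assert (HI : is_RInt (Fx s) x (X s) (F s (X s) - F s x)).
    { apply (is_RInt_derive (F s) (Fx s)); intros y Hy;
        pose proof (Omega_between _ _ _ Hx HXs Hy).
      - apply HF; auto.
      - apply continuous_of_continuity_2d, HFx; auto. }
    transitivity (RInt (fun y => - Fx s y) x (X s)).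
    + apply RInt_ext; intros y Hy; apply HDB; auto.
      apply (Omega_between _ _ _ Hx HXs); lra.
    + rewrite <- Ropp_minus_distr.
      apply is_RInt_unique, (is_RInt_opp (V := R_NormedModule) _ _ _ _ HI).
Qed.

(** * Growth of the speed *)

(** The terms in [w] rotate the vector [(V1, V2)], so they drop out of the
    derivative of its length and only the forcing [(e1, e2)] contributes. *)
Lemma speed_growth (V1 V2 e1 e2 w : R -> R) (t s C : R) :
  (forall r, Rabs (r - t) <= Rabs (s - t) ->
     is_derive V1 r (e1 r + V2 r * w r) /\
     is_derive V2 r (e2 r - V1 r * w r) /\
     enorm (e1 r, e2 r) <= C) ->
  enorm (V1 s, V2 s) <= enorm (V1 t, V2 t) + C * Rabs (s - t).
Proof.
  intros H; apply Rle_plus_epsilon; intros eps Heps.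
  (* The length is not differentiable at zero velocity; N is a smooth
     approximation from above, with error at most eps. *)
  set (N := fun r => sqrt (eps ^ 2 + (V1 r ^ 2 + V2 r ^ 2))).
  assert (HN0 : forall r, 0 < eps ^ 2 + (V1 r ^ 2 + V2 r ^ 2)) by (intros; nra).
  assert (HN : forall r, enorm (V1 r, V2 r) <= N r).
  { intros r; rewrite enormE; apply sqrt_le_1_alt; simpl; nra. }
  assert (HNt : N t <= enorm (V1 t, V2 t) + eps).
  { pose proof (enorm_ge0 (V1 t, V2 t)).
    pose proof (enorm_sqr (V1 t, V2 t)) as Hsq; simpl fst in Hsq; simpl snd in Hsq.
    unfold N; rewrite <- Hsq.
    rewrite <- (sqrt_pow2 (enorm (V1 t, V2 t) + eps)) by lra.
    apply sqrt_le_1_alt; nra. }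
  assert (HV : Rabs (N s - N t) <= C * Rabs (s - t)).
  { apply bounded_variation with
      (dh := fun r => (V1 r * e1 r + V2 r * e2 r) / N r).
    intros r Hr; destruct (H r Hr) as (H1 & H2 & H3); split.
    - unfold N; auto_derive.
      + repeat split; [eexists; exact H1 | eexists; exact H2 |].
        pose proof (HN0 r); lra.
      + replace (Derive (fun x => V1 x) r) with (e1 r + V2 r * w r)
          by (symmetry; apply is_derive_unique, H1).
        replace (Derive (fun x => V2 x) r) with (e2 r - V1 r * w r)
          by (symmetry; apply is_derive_unique, H2).
        replace (eps * (eps * 1) + (V1 r * (V1 r * 1) + V2 r * (V2 r * 1)))
          with (eps ^ 2 + (V1 r ^ 2 + V2 r ^ 2)) by ring.
        field; apply Rgt_not_eq, sqrt_lt_R0, HN0.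
    - assert (HNp : 0 < N r) by apply sqrt_lt_R0, HN0.
      unfold Rdiv; rewrite Rabs_mult, (Rabs_pos_eq (/ N r))
        by (apply Rlt_le, Rinv_0_lt_compat, HNp).
      apply Rle_div_l; [exact HNp |].
      pose proof (Cauchy_Schwarz_enorm (V1 r, V2 r) (e1 r, e2 r)) as CS.
      simpl in CS.
      pose proof (HN r); pose proof (enorm_ge0 (V1 r, V2 r));
        pose proof (enorm_ge0 (e1 r, e2 r)); nra. }
  pose proof (HN s); pose proof (Rle_abs (N s - N t)); lra.
Qed.

(** * The lower bound on the distance to the boundary *)

Lemma Rabs_bound_extends_to_endpoints (a b M : R) (g : R -> R) :
  a < b -> continuous_on (Icc a b) g ->
  (forall r, a < r < b -> Rabs (g r) <= M) ->
  forall s, Icc a b s -> Rabs (g s) <= M.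
Proof.
  intros Hab Hg HM s Hs; destruct (Rle_lt_dec (Rabs (g s)) M) as [|Hlt]; auto.
  exfalso.
  assert (He : 0 < Rabs (g s) - M) by lra.
  destruct (proj1 (filterlim_locally _ _) (Hg s Hs) (mkposreal _ He)) as [d Hd].
  set (h := Rmin (d / 2) ((b - a) / 4)).
  assert (Hh : 0 < h /\ h < d /\ h <= (b - a) / 4).
  { pose proof (cond_pos d); unfold h.
    split; [apply Rmin_case; lra |].
    pose proof (Rmin_l (d / 2) ((b - a) / 4)).
    pose proof (Rmin_r (d / 2) ((b - a) / 4)); lra. }
  assert (Hr : exists r, a < r < b /\ Rabs (r - s) < d).
  { unfold Icc in Hs; destruct (Rle_dec s ((a + b) / 2)).
    - exists (s + h); split; [lra | apply Rabs_def1; lra].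
    - exists (s - h); split; [lra | apply Rabs_def1; lra]. }
  destruct Hr as [r [Hr Hrd]].
  assert (Hbr : Rabs (g r - g s) < Rabs (g s) - M).
  { apply (Hd r Hrd); unfold Icc; lra. }
  pose proof (HM r Hr); pose proof (Rabs_triang_inv (g s) (g r)).
  rewrite (Rabs_minus_sym (g s)) in *; lra.
Qed.

Theorem lemma3p1 (T gamma c0 : R) (psi_ext B_ext : R -> R)
    (E : R -> R -> R * R) (B : R -> R -> R) (C0 C0' : R)
    (t x : R) (v : R * R) (X : R -> R) (V : R -> R * R) (alpha : R)
    (T_pos : 0 < T) (gamma_pos : 0 < gamma) (c0_pos : 0 < c0)
    (psi_C2 : C2_Omega psi_ext)
    (B_extE : forall y, Omega y -> is_derive psi_ext y (B_ext y))
    (psi_lower : forall y, Omega y ->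
       Rabs (psi_ext y) >= c0 / Rpower (dist_bdry y) gamma - 1 / c0)
    (E1_C1 : C1_cyl T (fun s y => fst (E s y)))
    (E2_C1 : C1_cyl T (fun s y => snd (E s y)))
    (B_C1 : C1_cyl T B)
    (faraday : forall s y, Icc 0 T s -> Omega y ->
       is_derive_within (Icc 0 T) (fun r => B r y) s
         (- Derive (fun z => snd (E s z)) y))
    (C0_pos : 0 < C0) (C0'_pos : 0 < C0')
    (E_bound : forall s y, Icc 0 T s -> Omega y -> enorm (E s y) <= C0)
    (B_bound : forall s y, Icc 0 T s -> Omega y -> Rabs (B s y) <= C0')
    (t_in : 0 < t <= T) (x_in : Omega x)
    (alpha_pos : 0 < alpha)
    (interval_in : 0 <= t - alpha /\ t + alpha <= T)
    (XV_sol : char_solution E B B_ext (t - alpha) (t + alpha) X V)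
    (X_init : X t = x) (V_init : V t = v) :
  forall s, Icc (t - alpha) (t + alpha) s ->
    Rpower (dist_bdry (X s)) gamma >=
      c0 / (/ c0 + 2 * enorm v + C0' + 3 * C0 * alpha + Rabs (psi_ext x)).

Proof.
  destruct XV_sol as (_ & _ & _ & Hsol).
  assert (Hin : forall r, t - alpha < r < t + alpha -> 0 < r < T) by (intros; lra).
  assert (Hode : forall r, t - alpha < r < t + alpha ->
            Omega (X r) /\
            is_derive X r (fst (hat (V r))) /\
            is_derive (fun q => fst (V q)) r
              (fst (E r (X r)) + snd (hat (V r)) * (B r (X r) + B_ext (X r))) /\
            is_derive (fun q => snd (V q)) r
              (snd (E r (X r)) - fst (hat (V r)) * (B r (X r) + B_ext (X r)))).
  { intros r Hr.
    assert (HD : locally r (Icc (t - alpha) (t + alpha))).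
    { generalize (locally_Ioo _ _ _ Hr); apply filter_imp; unfold Icc; intros; lra. }
    destruct (Hsol r) as (H1 & H2 & H3 & H4); [unfold Icc; lra |].
    split; [exact H1 |].
    repeat split; eapply is_derive_within_interior; eassumption. }
  assert (Hseg : forall s r, t - alpha < s < t + alpha ->
            Rabs (r - t) <= Rabs (s - t) -> t - alpha < r < t + alpha).
  { intros s r Hs Hr.
    assert (Hst : Rabs (s - t) < alpha) by (apply Rabs_def1; lra).
    destruct (Rabs_def2 (r - t) alpha) as [? ?]; lra. }
  assert (Hspeed : forall s, t - alpha < s < t + alpha ->
            enorm (V s) <= enorm v + C0 * Rabs (s - t)).
  { intros s Hs.
    rewrite <- V_init, (surjective_pairing (V s)), (surjective_pairing (V t)).
    apply (speed_growth (fun r => fst (V r)) (fun r => snd (V r))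
             (fun r => fst (E r (X r))) (fun r => snd (E r (X r)))
             (fun r => (B r (X r) + B_ext (X r)) / sqrt (1 + enorm (V r) ^ 2))).
    intros r Hr; destruct (Hode r (Hseg s r Hs Hr)) as (H1 & _ & H3 & H4).
    (* Both magnetic terms have the common angular velocity: the total field
       divided by the Lorentz factor. *)
    assert (Hw : forall a b c : R, a / c * b = a * (b / c)).
    { intros a b c; unfold Rdiv; ring. }
    unfold hat in H3, H4; simpl in H3, H4; rewrite Hw in H3, H4.
    split; [exact H3 | split; [exact H4 |]].
    rewrite <- surjective_pairing; apply E_bound; auto.
    pose proof (Hin r (Hseg s r Hs Hr)); unfold Icc; lra. }
  destruct E2_C1 as (_ & E2t & E2x & HE2 & _ & HE2x).
  assert (Hflux : forall s, t - alpha < s < t + alpha ->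
            is_derive (fun r => RInt (B r) x (X r)) s
              (snd (E s x) - snd (E s (X s)) + B s (X s) * fst (hat (V s)))).
  { intros s Hs; destruct (Hode s Hs) as (HXs & HX & _).
    apply (is_derive_RInt_of_conservation_law T B (fun r y => snd (E r y)) E2x); auto.
    - intros r y Hr Hy; exact (C0_cyl_interior T B r y (proj1 B_C1) Hr Hy).
    - intros r y Hr Hy; exact (C0_cyl_interior T E2x r y HE2x Hr Hy).
    - intros r y Hr Hy; apply HE2; auto; unfold Icc; lra.
    - intros r y Hr Hy.
      assert (HrT : Icc 0 T r) by (unfold Icc; lra).
      rewrite <- (is_derive_unique _ _ _ (proj2 (HE2 r y HrT Hy))).
      apply is_derive_within_interior with (D := Icc 0 T); auto.
      generalize (locally_Ioo _ _ _ Hr); apply filter_imp; unfold Icc; intros; lra. }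
  set (M := 2 * enorm v + C0' + 3 * C0 * alpha + Rabs (psi_ext x)).
  assert (Hpsi : forall s, t - alpha < s < t + alpha -> Rabs (psi_ext (X s)) <= M).
  { intros s Hs.
    destruct (Hode s Hs) as (HXs & _).
    set (P := fun r => snd (V r) + (RInt (B r) x (X r) + psi_ext (X r))).
    assert (HP : Rabs (P s - P t) <= C0 * Rabs (s - t)).
    { apply bounded_variation with (dh := fun r => snd (E r x)).
      intros r Hr; pose proof (Hseg s r Hs Hr) as Hr'.
      destruct (Hode r Hr') as (HXr & HX & _ & HV2); split.
      - pose proof (is_derive_comp _ _ _ _ _ (B_extE _ HXr) HX) as Hc.
        pose proof (is_derive_plus _ _ _ _ _ HV2
                      (is_derive_plus _ _ _ _ _ (Hflux r Hr') Hc)) as Hd.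
        refine (eq_ind _ (is_derive P r) Hd _ _).
        unfold plus, scal; simpl; unfold mult; simpl; ring.
      - eapply Rle_trans; [apply Rabs_snd_le_enorm |].
        apply E_bound; auto; pose proof (Hin r Hr'); unfold Icc; lra. }
    assert (HPt : P t = snd v + psi_ext x).
    { unfold P; rewrite X_init, V_init, RInt_point; unfold zero; simpl; ring. }
    assert (Hint : Rabs (RInt (B s) x (X s)) <= C0').
    { pose proof (Hin s Hs); apply Rabs_RInt_Omega_le; auto; intros z Hz.
      - apply continuous_of_continuity_2d.
        exact (C0_cyl_interior T B s z (proj1 B_C1) H Hz).
      - apply B_bound; auto; unfold Icc; lra. }
    assert (Hst : Rabs (s - t) < alpha) by (apply Rabs_def1; lra).
    pose proof (Hspeed s Hs) as HVs.
    pose proof (Rabs_snd_le_enorm (V s)); pose proof (Rabs_snd_le_enorm v).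
    rewrite HPt in HP; unfold P in HP.
    assert (Hmono : C0 * Rabs (s - t) <= C0 * alpha) by nra.
    assert (0 < C0 * alpha) by nra.
    unfold M; revert HP Hint H H0 HVs Hmono.
    unfold Rabs; repeat destruct Rcase_abs; intros; lra. }
  intros s Hs.
  destruct (Hsol s Hs) as (HXs & HX & _).
  assert (HpsiX : Rabs (psi_ext (X s)) <= M).
  { apply (Rabs_bound_extends_to_endpoints (t - alpha) (t + alpha) M
             (fun r => psi_ext (X r))); auto; [lra |].
    intros r Hr; destruct (Hsol r Hr) as (HXr & HXr' & _).
    eapply filterlim_comp.
    - apply (filterdiff_continuous_aux (F := within (Icc (t - alpha) (t + alpha)) (locally r)) X).
      + eexists; exact HXr'.
      + intros Q HQ; apply filter_le_within, HQ.
    - apply (ex_derive_continuous psi_ext); eexists; apply B_extE, HXr. }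
  assert (HM : 0 < / c0 + M).
  { pose proof (Rinv_0_lt_compat _ c0_pos); pose proof (Rabs_pos (psi_ext (X s))); lra. }
  pose proof (psi_lower (X s) HXs) as Hlow.
  set (D := Rpower (dist_bdry (X s)) gamma) in *.
  assert (HD : 0 < D) by apply exp_pos.
  apply Rle_ge.
  replace (/ c0 + 2 * enorm v + C0' + 3 * C0 * alpha + Rabs (psi_ext x))
    with (/ c0 + M) by (unfold M; ring).
  apply Rle_div_l; [exact HM |].
  rewrite Rmult_comm; apply Rle_div_l; [exact HD |].
  unfold Rdiv in Hlow |- *; rewrite Rmult_1_l in Hlow; lra.
Qed.
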